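(* Let $A$ be a complete commutative continuous inverse algebra, $G$ a compact group and $(A,G,\alpha)$ a dynamical system, with fixed point algebra $A^G$. Then the natural map on the level of spectra \[\Gamma_A\rightarrow\Gamma_{A^G},\qquad \chi\mapsto\chi|_{A^G},\] is surjective.
   Context: All algebras are complex. A unital locally convex algebra is a unital associative algebra that is a (Hausdorff) locally convex topological vector space with continuous multiplication; compact groups are Hausdorff topological groups. A continuous inverse algebra (CIA) is a unital locally convex algebra $A$ whose group of units $A^{\times}$ is open in $A$ and whose inversion map $\iota:A^{\times}\rightarrow A^{\times}$, $a\mapsto a^{-1}$, is continuous at $1_A$. It is called complete if it is complete as a locally convex space. A dynamical system $(A,G,\alpha)$ consists of a unital locally convex algebra $A$, a topological group $G$ and a group homomorphism $\alpha:G\rightarrow\mathrm{Aut}(A)$ (into the group of algebra automorphisms of $A$) which induces a continuous action $G\times A\rightarrow A$, $(g,a)\mapsto\alpha(g).a$. Its fixed point algebra is $A^G:=\{a\in A:\ \alpha(g).a=a\ \text{for all } g\in G\}$, with the subspace topology. For an algebra $B$, the spectrum $\Gamma_B:=\mathrm{Hom}_{\mathrm{alg}}(B,\mathbb{C})\setminus\{0\}$ is the set of all nonzero algebra homomorphisms $B\rightarrow\mathbb{C}$, endowed with the topology of pointwise convergence on $B$. *)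

(* Defs.v *)
From HB Require Import structures.
From mathcomp Require Import all_boot all_order all_algebra.
From mathcomp Require Import all_classical all_reals all_analysis.
From mathcomp Require Export complex.

Set Implicit Arguments.
Unset Strict Implicit.
Unset Printing Implicit Defensive.

Import GRing.Theory.

Local Open Scope classical_set_scope.
Local Open Scope ring_scope.

(* The library's algebras satisfy [1 != 0].  The zero algebra this leaves out has
   no nonzero homomorphism to a field, i.e. its spectrum is empty. *)
HB.mixin Record isLCAlgebra (K : numFieldType) A
    & GRing.Algebra K A & Tvs K A := {
  lcalg_hausdorff : hausdorff_space A;
  lcalg_mul_continuous : continuous (fun p : A * A => p.1 * p.2)
}.

#[short(type="lcAlgType")]
HB.structure Definition LCAlgebra (K : numFieldType) :=
  {A of GRing.Algebra K A & Tvs K A & isLCAlgebra K A}.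

(* Continuity of inversion at 1 is relative to the group of units:
   [GRing.inv] is total, with [a^-1 = a] off the units.  Classically every ring
   has a [unitRingType] structure, so [UnitAlgebra] is no restriction. *)
HB.mixin Record isContinuousInverseAlgebra (K : numFieldType) A
    & LCAlgebra K A & GRing.UnitAlgebra K A := {
  cia_open_unit : open [set a : A | a \is a GRing.unit];
  cia_inv_continuous_at1 :
    (fun a : A => a^-1) @ within [set a : A | a \is a GRing.unit] (nbhs 1)
      --> (1 : A)^-1
}.

#[short(type="ciaType")]
HB.structure Definition ContinuousInverseAlgebra (K : numFieldType) :=
  {A of LCAlgebra K A & GRing.UnitAlgebra K A
      & isContinuousInverseAlgebra K A}.

#[short(type="comCiaType")]
HB.structure Definition ComContinuousInverseAlgebra (K : numFieldType) :=
  {A of ContinuousInverseAlgebra K A & GRing.ComUnitAlgebra K A}.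

(* The uniform structure carried by a [tvsType] induces its topology, but is not
   required to be translation invariant.  Completeness of a topological vector
   space refers to the uniformity determined by the neighbourhoods of 0, hence
   the library's [cauchy] is not used here. *)
Definition tvs_cauchy (K : numFieldType) (E : tvsType K) (F : set_system E) :=
  forall U : set E, nbhs 0 U ->
    exists2 S : set E, F S & forall x y, S x -> S y -> U (x - y).

Definition tvs_complete (K : numFieldType) (E : tvsType K) :=
  forall F : set_system E, ProperFilter F -> tvs_cauchy F ->
    exists x : E, F --> x.

HB.mixin Record isTopologicalGroup G & Topological G & Group G := {
  topgroup_mul_continuous : continuous (fun p : G * G => (p.1 * p.2)%g);
  topgroup_inv_continuous : continuous (fun g : G => g^-1%g)
}.

#[short(type="topGroupType")]
HB.structure Definition TopologicalGroup :=
  {G of Topological G & Group G & isTopologicalGroup G}.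

Definition compact_group (G : topGroupType) :=
  hausdorff_space G /\ compact [set: G].

Record dynamical_system (K : numFieldType) (A : lcAlgType K)
    (G : topGroupType) := DynamicalSystem {
  dyn_act :> G -> {lrmorphism A -> A};
  dyn_bij : forall g, bijective (dyn_act g);
  dyn_mul : forall g h a, dyn_act (g * h)%g a = dyn_act g (dyn_act h a);
  dyn_continuous : continuous (fun p : G * A => dyn_act p.1 p.2)
}.

Section FixedPointAlgebra.
Variables (K : numFieldType) (A : lcAlgType K) (G : topGroupType).
Variable alpha : dynamical_system A G.

Definition fixed_points : set A := [set a | forall g, alpha g a = a].

Definition fixed_algebra : Type := set_type fixed_points.

HB.instance Definition _ := SubChoice.on fixed_algebra.
HB.instance Definition _ := Topological.on fixed_algebra.

Let fixed_subalg_closed : subalg_closed (mem fixed_points).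
Proof.
split=> [|k a b /set_mem ha /set_mem hb|a b /set_mem ha /set_mem hb];
  apply/mem_set => g.
- by rewrite rmorph1.
- by rewrite linearP/= ha hb.
- by rewrite rmorphM/= ha hb.
Qed.

HB.instance Definition _ := GRing.SubChoice_isSubAlgebra.Build
  K A (mem fixed_points) fixed_algebra
  (GRing.subalg_closed_semi fixed_subalg_closed).

End FixedPointAlgebra.

Section Spectrum.
Variable R : realType.
Local Notation C := R[i].

(* [C^o] carries the topology given by the modulus, and [{ptws _ -> _}] that of
   pointwise convergence.  Algebra homomorphisms are not assumed unital. *)
Definition characters (B : algType C) : set {ptws B -> C^o} :=
  [set chi | [/\ scalar (chi : B -> C),
                 {morph (chi : B -> C) : x y / x * y} &
                 exists b, chi b != 0]].
Arguments characters B : clear implicits.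

Definition spectrum (B : algType C) : topologicalType :=
  set_type (characters B).

Definition char_fun (B : algType C) (chi : spectrum B) : B -> C := \val chi.

Variables (A : lcAlgType C) (G : topGroupType) (alpha : dynamical_system A G).

Lemma char_restrict_subproof (chi : spectrum A) :
  ((fun a => char_fun chi (\val a)) : {ptws fixed_algebra alpha -> C^o})
    \in characters (fixed_algebra alpha).
Proof.
have [lchi mchi [b b0]] := set_mem (valP chi).
have valL (k : C) x y : \val (k *: x + y : fixed_algebra alpha) =
    k *: \val x + \val y by exact: linearP.
have valM x y : \val (x * y : fixed_algebra alpha) = \val x * \val y.
  exact: rmorphM.
have val1 : \val (1 : fixed_algebra alpha) = 1 by exact: rmorph1.
apply/mem_set; split=> [k x y|x y|].
- by rewrite valL; apply: lchi.
- by rewrite valM; apply: mchi.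
- exists 1; rewrite val1; apply: contraNneq b0 => chi1.
  rewrite -[b]mulr1; apply/eqP; rewrite mchi.
  by rewrite [X in _ * X](_ : _ = 0) ?mulr0 //; exact: chi1.
Qed.

Definition char_restrict (chi : spectrum A) : spectrum (fixed_algebra alpha) :=
  SigSub (char_restrict_subproof chi).

End Spectrum.

(* Main.v *)
Require Import Defs.
From mathcomp Require Import all_boot all_order all_algebra.
From mathcomp Require Import all_classical all_reals all_analysis.
From mathcomp Require Import ring lra.

(** Averaging over [G] gives an [A^G]-linear projection [c : A -> A^G] with
    [c 1 = 1].  For a character [psi] of [A^G], the elements [x] with
    [psi (c (x y)) = 0] for all [y] form a proper ideal of [A] containing
    [ker psi].  A maximal ideal [M] above it has residue field [C]
    (Gelfand-Mazur), and the quotient map [A -> A / M = C] extends [psi].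

    No Haar measure is needed: finite averages [P_s a] of the orbit of [a] can
    be made almost [G]-invariant, because averaging over sufficiently dense
    finite subsets of [G] contracts the oscillation of a continuous function by
    a constant factor; almost invariant averages form a Cauchy filter, and
    [c a] is its limit.

    Gelfand-Mazur is proved without duality or complex integration: if
    [S z = (a - z)^-1] existed modulo [M] for all [z], then a seminorm
    [u z = p (S z)] on [A / M] would tend to [0] at infinity and satisfy the
    mean inequality [4 u(z) <= sum_k u(z + i^k h) + O(h^3)], so [u = 0] by a
    maximum principle. *)

Set Implicit Arguments.
Unset Strict Implicit.
Unset Printing Implicit Defensive.

Import Order.TTheory GRing.Theory Num.Theory.
Import numFieldNormedType.Exports.

Local Open Scope classical_set_scope.
Local Open Scope ring_scope.
Local Open Scope complex_scope.

(** * Seminorms and Minkowski functionals *)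

Section ComplexModulus.
Variable R : realType.
Implicit Types z w : R[i].

(** The norm of [R[i]] takes its values in [R[i]], which is only partially ordered; seminorms need a
    modulus in the ordered field [R]. *)
Definition modulus z : R := Normc.normc z.

Lemma norm_modulus z : `|z| = (modulus z)%:C.
Proof. by case: z. Qed.

Lemma modulus_ge0 z : 0 <= modulus z.
Proof. by rewrite -ler0c -norm_modulus. Qed.

Lemma modulusM z w : modulus (z * w) = modulus z * modulus w.
Proof. exact: Normc.normcM. Qed.

Lemma modulus0 : modulus 0 = 0.
Proof. exact: Normc.normc0. Qed.

Lemma modulus1 : modulus 1 = 1.
Proof. exact: Normc.normc1. Qed.

Lemma modulusN z : modulus (- z) = modulus z.
Proof. exact: normcN. Qed.

Lemma modulusV z : modulus z^-1 = (modulus z)^-1.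
Proof. exact: Normc.normcV. Qed.

Lemma modulus_eq0 z : (modulus z == 0) = (z == 0).
Proof. by apply/eqP/eqP => [/Normc.eq0_normc//|->]; rewrite modulus0. Qed.

Lemma modulusR (t : R) : modulus t%:C = `|t|.
Proof.
by apply: complexI; rewrite -norm_modulus normc_def/= expr0n addr0 sqrtr_sqr.
Qed.

Lemma modulus_le_ReIm (x y : R) :
  modulus (x +i* y) <= `|x| + `|y|.
Proof.
rewrite /modulus/= -[leRHS]ger0_norm ?addr_ge0// -sqrtr_sqr ler_wsqrtr//.
by rewrite sqrrD !real_normK ?num_real// addrAC lerDl mulrn_wge0// mulr_ge0.
Qed.

Lemma modulus_ge_Re (x y : R) : `|x| <= modulus (x +i* y).
Proof. by rewrite /modulus/= -sqrtr_sqr ler_wsqrtr// lerDl sqr_ge0. Qed.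

Lemma modulus_ge_Im (x y : R) : `|y| <= modulus (x +i* y).
Proof. by rewrite /modulus/= -sqrtr_sqr ler_wsqrtr// lerDr sqr_ge0. Qed.

End ComplexModulus.

Section Seminorm.
Variables (R : realType) (E : tvsType R[i]).
Implicit Types (p : E -> R) (U W : set E) (x y : E).

Definition cseminorm p := [/\ forall x y, p (x + y) <= p x + p y,
  forall (a : R[i]) x, p (a *: x) = modulus a * p x &
  forall e : R, 0 < e -> nbhs 0 [set x | p x < e]].

Section Theory.
Variables (p : E -> R) (hp : cseminorm p).

Lemma seminormD x y : p (x + y) <= p x + p y. Proof. by case: hp. Qed.

Lemma seminormZ (a : R[i]) x : p (a *: x) = modulus a * p x.
Proof. by case: hp. Qed.

Lemma seminorm_nbhs0 (e : R) : 0 < e -> nbhs 0 [set x | p x < e].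
Proof. by case: hp => _ _; apply. Qed.

Lemma seminorm0 : p 0 = 0.
Proof. by rewrite -(scale0r (0 : E)) seminormZ modulus0 mul0r. Qed.

Lemma seminormN x : p (- x) = p x.
Proof. by rewrite -scaleN1r seminormZ modulusN modulus1 mul1r. Qed.

Lemma seminormB x y : p (x - y) <= p x + p y.
Proof. by rewrite -(seminormN y) seminormD. Qed.

Lemma seminormBC x y : p (x - y) = p (y - x).
Proof. by rewrite -opprB seminormN. Qed.

Lemma seminorm_ge0 x : 0 <= p x.
Proof.
have := seminormB x x; rewrite subrr seminorm0 -mulr2n pmulrn_lge0 //.
Qed.

Lemma seminorm_sum I (s : seq I) (F : I -> E) :
  p (\sum_(i <- s) F i) <= \sum_(i <- s) p (F i).
Proof.
elim: s => [|i s IH]; first by rewrite !big_nil seminorm0.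
by rewrite !big_cons (le_trans (seminormD _ _))// lerD2l.
Qed.

Lemma seminorm_nbhs x (e : R) : 0 < e -> nbhs x [set y | p (y - x) < e].
Proof.
move=> e0; have /= := nbhsT x (seminorm_nbhs0 e0).
by apply: filterS => _ [y py <-]/=; rewrite addrC addKr.
Qed.

Lemma seminorm_dist x y : `|p x - p y| <= p (x - y).
Proof.
rewrite ler_norml; apply/andP; split.
  by rewrite lerNl opprB lerBlDr seminormBC (le_trans _ (seminormD _ _)) ?subrK.
by rewrite lerBlDr (le_trans _ (seminormD _ _)) ?subrK.
Qed.

End Theory.

Lemma cseminormD p q : cseminorm p -> cseminorm q ->
  cseminorm (fun x => p x + q x).
Proof.
move=> hp hq; split=> [x y|a x|e e0].
- by rewrite addrACA lerD ?seminormD.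
- by rewrite !seminormZ// mulrDr.
- have e2 : 0 < e / 2 by rewrite divr_gt0.
  apply: filterS2 (seminorm_nbhs0 hp e2) (seminorm_nbhs0 hq e2) => x/= px qx.
  by rewrite [ltRHS](splitr e) ltrD.
Qed.

Lemma cseminormZ p (c : R) :
  0 < c -> cseminorm p -> cseminorm (fun x => c * p x).
Proof.
move=> c0 hp; split=> [x y|a x|e e0].
- by rewrite -mulrDr ler_pM2l// seminormD.
- by rewrite (seminormZ hp) mulrCA.
- have ec : 0 < e / c by rewrite divr_gt0.
  apply: filterS (seminorm_nbhs0 hp ec) => x/=.
  by rewrite ltr_pdivlMr// mulrC.
Qed.

Lemma cseminorm0 :
  cseminorm (fun _ : E => 0).
Proof.
split=> [x y|a x|e e0]; rewrite ?addr0 ?mulr0 //.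
by apply: filterS filterT.
Qed.

(** Convexity and balancedness in one condition; on nonempty sets it also forces [0] to belong to
    [U]. *)
Definition absconvex U := forall (a b : R[i]) x y, U x -> U y ->
  modulus a + modulus b <= 1 -> U (a *: x + b *: y).

Lemma scale_near0 W x : nbhs 0 W -> exists2 d : R, 0 < d &
  exists2 N : set E, nbhs x N &
    forall (a : R[i]) y, modulus a < d -> N y -> W (a *: y).
Proof.
move=> W0.
have /= := @scale_continuous _ E (0, x) W; rewrite scale0r => /(_ W0).
case=> -[B N]/= [B0 Nx] BNW.
have [/= d d0 dB] : nbhs_ball (0 : R[i]^o) B by rewrite nbhs_ballE.
have dRe : (complex.Re d)%:C = d by rewrite RRe_real// ger0_real// ltW.
exists (complex.Re d); first by rewrite -ltcR dRe.
exists N => // a y ad Ny; apply: (BNW (a, y)); split=> //=.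
by apply: dB; rewrite -ball_normE/= sub0r normrN norm_modulus -dRe ltcR.
Qed.

Lemma scale_small W x : nbhs 0 W -> exists2 d : R, 0 < d &
  forall a : R[i], modulus a < d -> W (a *: x).
Proof.
move=> /(scale_near0 x)[d d0 [N Nx dNW]]; exists d => // a ad.
by apply: dNW => //; exact: nbhs_singleton.
Qed.

Lemma convex_nbhs0 W : nbhs 0 W -> exists V : set E,
  [/\ nbhs 0 V, V `<=` W & forall (t : R) x y, 0 <= t <= 1 -> V x -> V y ->
    V (t%:C *: x + (1 - t)%:C *: y)].
Proof.
move=> W0; have [B Bconv [Bopen Bbasis]] := @locally_convex _ E.
have [V [BV V0] VW] := Bbasis 0 W W0.
exists V; split=> //; first by apply: open_nbhs_nbhs; split=> //; exact: Bopen.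
move=> t x y t01 Vx Vy.
have t01C : (0 : R[i]) <= t%:C <= 1 by rewrite ler0c lecR.
have -> : (1 - t)%:C = 1 - t%:C :> R[i] by rewrite rmorphB rmorph1.
apply: set_mem.
exact: (Bconv V (mem_set BV) x y (Itv01 (proj1 (andP t01C)) (proj2 (andP t01C)))
  (mem_set Vx) (mem_set Vy)).
Qed.

Lemma absconvex_nbhs0 W : nbhs 0 W ->
  exists U, [/\ nbhs 0 U, U `<=` W & absconvex U].
Proof.
move=> /convex_nbhs0[V [V0 VW Vconv]].
(* The balanced core of [V]. Joint continuity of scaling at [(0, 0)] makes it a neighbourhood of
   [0]. *)
exists [set x | forall c : R[i], modulus c <= 1 -> V (c *: x)]; split.
- have [d d0 [N N0 dNV]] := scale_near0 0 V0.
  have d20 : 0 < d / 2 by rewrite divr_gt0.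
  have d2C : (d / 2)%:C != 0 :> R[i].
    by rewrite -modulus_eq0 modulusR normr_eq0 gt_eqF.
  have := nbhs0Z d2C N0; apply: filterS => _ [x Nx <-] c c1.
  rewrite scalerA; apply: dNV => //; rewrite modulusM modulusR gtr0_norm//.
  by rewrite (le_lt_trans (ler_piMl _ c1)) ?ltW// ltr_pdivrMr// ltr_pMr// ltr1n.
- by move=> x /(_ 1); rewrite scale1r modulus1 => /(_ (lexx _))/VW.
- have V_0 : V 0 by exact: nbhs_singleton.
  have phase (a : R[i]) : (modulus a)%:C * (a / (modulus a)%:C) = a.
    have [->|a0] := eqVneq a 0; first by rewrite mul0r mulr0.
    rewrite mulrCA mulfV ?mulr1// -modulus_eq0 modulusR normr_eq0.
    by rewrite modulus_eq0.
  have phase1 (a : R[i]) : modulus (a / (modulus a)%:C) <= 1.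
    rewrite modulusM modulusV modulusR ger0_norm ?modulus_ge0//.
    have [->|a0] := eqVneq (modulus a) 0; first by rewrite mul0r.
    by rewrite divff.
  have scl x (t : R) : 0 <= t <= 1 -> V x -> V (t%:C *: x).
    move=> t01 Vx; rewrite -[_ *: x]addr0 -(scaler0 _ (1 - t)%:C).
    exact: Vconv.
  have comb (a b : R) x y : 0 <= a -> 0 <= b -> a + b <= 1 -> V x -> V y ->
      V (a%:C *: x + b%:C *: y).
    move=> a0 b0 ab1 Vx Vy.
    have [ab0|abn0] := eqVneq (a + b) 0.
      move/eqP: ab0; rewrite paddr_eq0// => /andP[/eqP-> /eqP->].
      by rewrite !scale0r addr0.
    have abp : 0 < a + b by rewrite lt_def abn0 addr_ge0.
    have -> : a%:C *: x + b%:C *: y = (a + b)%:C *: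
        ((a / (a + b))%:C *: x + (1 - a / (a + b))%:C *: y).
      rewrite scalerDr !scalerA -!rmorphM mulrBr mulr1 mulrCA divff// mulr1.
      by rewrite addrAC subrr add0r.
    apply: scl; first by rewrite addr_ge0.
    apply: Vconv => //; rewrite divr_ge0 ?addr_ge0//= ler_pdivrMr// mul1r.
    by rewrite lerDl.
  (* Each coefficient is its modulus times a phase (the phase of [0] being [0]): the core absorbs
     the phases, and convexity of [V] handles the moduli. *)
  move=> a b x y Ux Uy ab1 c c1.
  have := comb (modulus (c * a)) (modulus (c * b))
    ((c * a / (modulus (c * a))%:C) *: x) ((c * b / (modulus (c * b))%:C) *: y).
  rewrite scalerDr !scalerA !phase !modulusM -mulrDr; apply.
  - by rewrite mulr_ge0 ?modulus_ge0.
  - by rewrite mulr_ge0 ?modulus_ge0.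
  - by rewrite mulr_ile1// ?modulus_ge0// addr_ge0 ?modulus_ge0.
  - by apply: Ux; rewrite -modulusM.
  - by apply: Uy; rewrite -modulusM.
Qed.

Definition gauge_set U x : set R :=
  [set t | 0 < t /\ exists2 y, U y & x = t%:C *: y].

(* Minkowski functional; [inf] is only meaningful for absorbing [U] *)
Definition gauge U x : R := inf (gauge_set U x).

Section Gauge.
Variables (U : set E) (U0 : nbhs 0 U) (Uconv : absconvex U).

Let gauge_lb x : has_lbound (gauge_set U x).
Proof. by exists 0 => t [/ltW]. Qed.

Let gauge_set_nonempty x : gauge_set U x !=set0.
Proof.
have [d d0 dU] := scale_small x U0.
exists (d / 2)^-1; split; first by rewrite invr_gt0 divr_gt0.
have d20 : 0 < d / 2 by rewrite divr_gt0.
exists ((d / 2)%:C *: x).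
  apply: dU; rewrite modulusR gtr0_norm//.
  by rewrite ltr_pdivrMr// ltr_pMr// ltr1n.
by rewrite scalerA -rmorphM/= mulVf ?gt_eqF// rmorph1 scale1r.
Qed.

Lemma gauge_le t x : gauge_set U x t -> gauge U x <= t.
Proof. by move=> xt; apply: ge_inf. Qed.

Lemma gauge_lt t x : gauge U x < t -> gauge_set U x t.
Proof.
move=> /(inf_lt (gauge_set_nonempty x))[s [s0 [y Uy ->]] st].
have t0 := lt_trans s0 st.
split=> //; exists ((s / t)%:C *: y).
  have := @Uconv (s / t)%:C 0 y y Uy Uy; rewrite scale0r addr0 modulus0 addr0.
  apply; rewrite modulusR ger0_norm ?divr_ge0 ?ltW//.
  by rewrite ltr_pdivrMr// mul1r.
by rewrite scalerA -rmorphM/= mulrCA divff ?mulr1// gt_eqF.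
Qed.

Lemma gauge_lt1 x : gauge U x < 1 -> U x.
Proof. by move=> /gauge_lt[_ [y Uy ->]]; rewrite rmorph1 scale1r. Qed.

Let gaugeZ_le (a : R[i]) x : gauge U (a *: x) <= modulus a * gauge U x.
Proof.
apply/ler_addgt0Pr => e e0.
pose t := gauge U x + e / (modulus a + 1).
have a1 : 0 < modulus a + 1 by rewrite ltr_wpDl ?modulus_ge0.
have xt : gauge U x < t by rewrite ltrDl divr_gt0.
have [t0 [y Uy xE]] := gauge_lt xt.
have [a0|a0] := eqVneq a 0.
  rewrite a0 scale0r modulus0 mul0r add0r; apply: gauge_le; split=> //.
  by exists 0; [exact: nbhs_singleton|rewrite scaler0].
have ma0 : 0 < modulus a by rewrite lt_def modulus_eq0 a0 modulus_ge0.
apply: (@le_trans _ _ (modulus a * t)).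
  apply: gauge_le; split; first exact: mulr_gt0.
  exists ((a / (modulus a)%:C) *: y).
    have := @Uconv (a / (modulus a)%:C) 0 y y Uy Uy.
    rewrite scale0r addr0 modulus0 addr0; apply.
    by rewrite modulusM modulusV modulusR gtr0_norm// divff ?gt_eqF.
  rewrite xE !scalerA rmorphM/= mulrAC; congr (_ * _ *: _).
  rewrite mulrCA divff ?mulr1// -modulus_eq0 modulusR normr_eq0 gt_eqF//.
rewrite mulrDr lerD2l mulrCA ger_pMr// ler_pdivrMr// mul1r lerDl//.
Qed.

Let gauge_ge0 x : 0 <= gauge U x.
Proof. by apply: lb_le_inf => // t [/ltW]. Qed.

Lemma gauge_cseminorm : cseminorm (gauge U).
Proof.
split=> [x y|a x|e e0].
- apply/ler_addgt0Pr => e e0.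
  have e20 : 0 < e / 2 by rewrite divr_gt0.
  have [s0 [u Uu xE]] : gauge_set U x (gauge U x + e / 2).
    by apply: gauge_lt; rewrite ltrDl.
  have [t0 [v Uv yE]] : gauge_set U y (gauge U y + e / 2).
    by apply: gauge_lt; rewrite ltrDl.
  move: s0 t0 xE yE.
  rewrite (_ : gauge U x + gauge U y + e =
    (gauge U x + e / 2) + (gauge U y + e / 2)); last first.
    by rewrite addrACA -splitr.
  set s := _ + e / 2; set t := _ + e / 2 => s0 t0 xE yE.
  have st0 : 0 < s + t by rewrite addr_gt0.
  apply: gauge_le; split=> //.
  exists ((s / (s + t))%:C *: u + (t / (s + t))%:C *: v).
    apply: Uconv => //; rewrite !modulusR !gtr0_norm ?divr_gt0//.
    by rewrite -mulrDl divff// gt_eqF.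
  rewrite scalerDr !scalerA -!rmorphM/= xE yE.
  have stK r : (s + t) * (r / (s + t)) = r.
    by rewrite mulrCA divff ?mulr1// gt_eqF.
  by rewrite !stK.
- apply/eqP; rewrite eq_le gaugeZ_le/=.
  have [->|a0] := eqVneq a 0; first by rewrite modulus0 mul0r.
  have ma0 : 0 < modulus a by rewrite lt_def modulus_eq0 a0 modulus_ge0.
  have := gaugeZ_le a^-1 (a *: x).
  by rewrite scalerA mulVf// scale1r modulusV ler_pdivlMl.
- have e20 : 0 < e / 2 by rewrite divr_gt0.
  have eC : (e / 2)%:C != 0 :> R[i].
    by rewrite -modulus_eq0 modulusR normr_eq0 gt_eqF.
  have := nbhs0Z eC U0; apply: filterS => _ [x Ux <-]/=.
  apply: (@le_lt_trans _ _ (e / 2)).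
    by apply: gauge_le; split=> //; exists x.
  by rewrite ltr_pdivrMr// ltr_pMr// ltr1n.
Qed.

End Gauge.

(** The gauge of an absolutely convex neighbourhood inside [W] is such a seminorm. A single seminorm
    thus controls any given neighbourhood of [0]. *)
Lemma seminorm_basis W : nbhs 0 W ->
  exists2 p : E -> R, cseminorm p & [set x | p x < 1] `<=` W.
Proof.
move=> /absconvex_nbhs0[U [U0 UW Uconv]].
exists (gauge U); first exact: gauge_cseminorm.
by apply: subset_trans UW => x; exact: gauge_lt1.
Qed.

(** Every neighbourhood of [x] contains [0]: its preimage under [y |-> x - y] is a neighbourhood of
    [0], and [x], on which all seminorms vanish, lies in it. *)
Lemma seminorm_separated x : hausdorff_space E ->
  (forall p, cseminorm p -> p x = 0) -> x = 0.
Proof.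
move=> hE px; apply: hE => A B Ax B0.
have : nbhs 0 [set y | A (x - y)].
  have /= := @sub_continuous E (x, 0) A; rewrite subr0 => /(_ Ax)[[B1 B2]/= []].
  move=> B1x B20 BA; apply: filterS B20 => y B2y.
  by apply: (BA (x, y)); split=> //=; exact: nbhs_singleton.
move=> /filterI/(_ B0)/seminorm_basis[p hp pAB].
have /pAB[/= + _] : p x < 1 by rewrite px.
by rewrite subrr => A0; exists 0; split=> //; exact: nbhs_singleton.
Qed.
End Seminorm.

(** * The averaging projection onto the fixed point algebra *)

Section Mean.
Variables (R : realType) (E : lmodType R[i]).

(** Repetitions in [s] count as weights, so means compose over product lists. The mean over the
    empty list is [0], whence the conditions [s <> [::]] below. *)
Definition mean (I : Type) (s : seq I) (f : I -> E) : E :=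
  (size s)%:R^-1 *: \sum_(i <- s) f i.

Lemma meanD I (s : seq I) (f g : I -> E) :
  mean s (fun i => f i + g i) = mean s f + mean s g.
Proof. by rewrite /mean big_split scalerDr. Qed.

Lemma meanB I (s : seq I) (f g : I -> E) :
  mean s (fun i => f i - g i) = mean s f - mean s g.
Proof. by rewrite /mean sumrB scalerBr. Qed.

Lemma mean_cst I (s : seq I) (x : E) : s <> [::] -> mean s (fun=> x) = x.
Proof.
move=> s0; rewrite /mean big_const_seq count_predT iter_addr_0.
rewrite -[x *+ _]scaler_nat scalerA mulVf ?scale1r//.
by rewrite pnatr_eq0; case: s s0.
Qed.

Lemma mean_allpairs I J L (h : I -> J -> L) (s : seq I) (t : seq J)
    (f : L -> E) :
  mean [seq h i j | i <- s, j <- t] f =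
  mean s (fun i => mean t (fun j => f (h i j))).
Proof.
rewrite /mean big_allpairs_dep size_allpairs natrM invfM -scalerA.
congr (_ *: _).
by rewrite scaler_sumr.
Qed.

Lemma mean_exchange I J (s : seq I) (t : seq J) (f : I -> J -> E) :
  mean s (fun i => mean t (f i)) = mean t (fun j => mean s (f ^~ j)).
Proof.
rewrite /mean -!scaler_sumr !scalerA mulrC; congr (_ *: _).
exact: exchange_big.
Qed.

End Mean.

Lemma allpairs_neq0 I J L (h : I -> J -> L) (s : seq I) (t : seq J) :
  s <> [::] -> t <> [::] -> [seq h i j | i <- s, j <- t] <> [::].
Proof. by case: s => // i s; case: t. Qed.

Section SeminormMean.
Variables (R : realType) (E : tvsType R[i]) (p : E -> R) (hp : cseminorm p).

Lemma modulus_natV n : modulus (n%:R^-1 : R[i]) = n%:R^-1.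
Proof.
by rewrite modulusV -(rmorph_nat (real_complex R)) modulusR ger0_norm.
Qed.

Lemma seminorm_mean (I : Type) (s : seq I) (f : I -> E) (d : R) :
  s <> [::] -> (forall i, p (f i) <= d) -> p (mean s f) <= d.
Proof.
move=> s0 fd; rewrite /mean (seminormZ hp) modulus_natV.
have n0 : (0 : R) < (size s)%:R by rewrite ltr0n; case: s s0.
rewrite mulrC ler_pdivrMr// (le_trans (seminorm_sum hp _ _))//.
rewrite (le_trans (ler_sum _ (fun i _ => fd i)))//.
by rewrite big_const_seq count_predT iter_addr_0 mulr_natr.
Qed.

Lemma seminorm_sumB (I J : Type) (s : seq I) (t : seq J) (f : I -> E)
    (g : J -> E) (d : R) : size s = size t ->
  (forall i j, p (f i - g j) <= d) ->
  p (\sum_(i <- s) f i - \sum_(j <- t) g j) <= (size s)%:R * d.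
Proof.
move=> + fg; elim: s t => [|i s IH] [|j t]//=.
  by rewrite !big_nil subrr seminorm0// mul0r.
move=> [/IH st]; rewrite !big_cons opprD addrACA (le_trans (seminormD hp _ _))//.
by rewrite mulrSr mulrDl mul1r [leRHS]addrC lerD.
Qed.

End SeminormMean.

(** * Averaging continuous functions on a compact group *)

Section Oscillation.
Variables (R : realType) (E : tvsType R[i]) (G : topGroupType).
Hypothesis G_compact : compact [set: G].
Variables (p : E -> R) (hp : cseminorm p).
Variables (f : G -> E) (f_cont : continuous f).

(** Continuity at [(1, x)] gives the estimate for [v] near [1] and points near [x]; compactness of
    [G] makes it uniform in [x]. *)
Lemma uniform_translation (e : R) : 0 < e ->
  \forall v \near (1%g : G), forall x, p (f (v * x)%g - f x) <= e.
Proof.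
move=> e0; have e20 : 0 < e / 2 by rewrite divr_gt0.
suff : \forall v \near (1%g : G),
    [set: G] `<=` (fun x => p (f (v * x)%g - f x) <= e).
  by apply: filterS => v Pv x; exact: Pv.
apply: ((compact_near_coveringP _).1 G_compact G (nbhs (1%g : G))
  (fun v x => p (f (v * x)%g - f x) <= e)).
  move=> x _.
  have fx := f_cont (seminorm_nbhs hp (f x) e20).
  have mx : \forall q \near ((1%g : G), x), p (f (q.1 * q.2)%g - f x) < e / 2.
    have := @topgroup_mul_continuous G (1%g, x) _; rewrite /= mul1g.
    by move=> /(_ _ fx).
  case: mx => -[V X]/= [V1 Xx] VX.
  exists (X `&` [set y | p (f y - f x) < e / 2], V).
    by split=> //=; apply: filterI.
  move=> [y v]/= [[Xy fy] Vv].
  have /= vy := VX (v, y) (conj Vv Xy).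
  rewrite -(subrKA (f x)) (le_trans (seminormD hp _ _))// [leRHS]splitr.
  by rewrite lerD// ltW// seminormBC.
Qed.

Lemma finite_cover_translates (V : set G) : nbhs (1%g : G) V ->
  exists c : seq G, forall g, exists2 k, k \in c & V (g * k)%g.
Proof.
move=> V1.
(* The filter of properties shared by all sufficiently large finite lists: compactness then turns
   local choices of [k] into one list. *)
pose F : set_system (seq G) := [set Q | exists c0 : seq G,
  forall c : seq G, {subset c0 <= c} -> Q c].
have FF : Filter F.
  split.
  - by exists [::].
  - move=> P Q [c Pc] [d Qd]; exists (c ++ d) => e cde; split.
      by apply: Pc => k kc; apply: cde; rewrite mem_cat kc.
    by apply: Qd => k kd; apply: cde; rewrite mem_cat kd orbT.
  - by move=> P Q PQ [c Pc]; exists c => d cd; apply/PQ/Pc.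
have := (compact_near_coveringP _).1 G_compact (seq G) F
  (fun c g => exists2 k, k \in c & V (g * k)%g) FF.
case=> [g _|c cP]; last by exists c => g; apply: cP.
have gV : nbhs g [set h | V (h * g^-1)%g].
  have /= := @topgroup_mul_continuous G (g, g^-1%g) V; rewrite mulgV.
  move=> /(_ V1)[[X Y]/= [Xg Yg] XY]; apply: filterS Xg => h Xh.
  by apply: (XY (h, g^-1%g)); split=> //=; exact: nbhs_singleton.
exists ([set h | V (h * g^-1)%g], [set c : seq G | g^-1%g \in c]).
  by split=> //=; exists [:: g^-1%g] => c; apply; rewrite mem_head.
by move=> [h c]/= [Vh gc]; exists g^-1%g.
Qed.

(* Averaging over translates that bring every point close to the identity
   shrinks the oscillation by the factor [1 - 1/n]: for any [g] and [h], one
   pair of the [n] terms of the two averages is nearly equal. *)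
Lemma oscillation_contract (F : G -> E) (c : seq G) (V : set G) (e d : R) :
  (forall g, exists2 k, k \in c & V (g * k)%g) ->
  (forall v, V v -> p (F v - F 1%g) <= e) ->
  (forall g h, p (F g - F h) <= d) ->
  forall g h, p (mean c (fun k => F (g * k)%g) - mean c (fun k => F (h * k)%g))
    <= (size c)%:R^-1 * (e + e + (size c).-1%:R * d).
Proof.
move=> cV Fe Fd g h.
have [i ic Vi] := cV g; have [j jc Vj] := cV h.
rewrite /mean -scalerBr (seminormZ hp) modulus_natV ler_wpM2l ?invr_ge0//.
rewrite (big_rem i)//= (big_rem j jc)/= opprD addrACA.
rewrite (le_trans (seminormD hp _ _))// lerD//.
  rewrite -(subrKA (F 1%g)) (le_trans (seminormD hp _ _))// lerD ?Fe//.
  by rewrite seminormBC// Fe.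
by rewrite -(size_rem ic) seminorm_sumB// !size_rem.
Qed.

Lemma oscillation_mean (e : R) : 0 < e -> exists2 s : seq G, s <> [::] &
  forall g h, p (mean s (fun k => f (g * k)%g) - mean s (fun k => f (h * k)%g))
    <= e.
Proof.
(* After [N] rounds of averaging the oscillation is at most [e' + e' + q ^+ N * d0]; half of [e] is
   reserved for the constant part and half for the geometric part. *)
move=> e0; pose e' := e / 4.
have e'0 : 0 < e' by rewrite divr_gt0.
have [/= c cV] := finite_cover_translates (uniform_translation e'0).
have c0 : c <> [::] by have [k] := cV 1%g; case: c {cV}.
pose n := size c.
have n0 : (0 : R) < n%:R by rewrite ltr0n /n; case: (c) c0.
pose q : R := n.-1%:R / n%:R.
have q0 : 0 <= q by rewrite divr_ge0.
have q1 : q < 1.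
  by rewrite ltr_pdivrMr// mul1r ltr_nat prednK// -(ltr0n R).
(* A crude bound on the initial oscillation: each [f x] is within [e'] of one of the finitely many
   [f k^-1]. *)
pose d0 := 2 * (e' + \sum_(k <- c) p (f k^-1%g)).
have d0P g h : p (f g - f h) <= d0.
  suff fd x : p (f x) <= e' + \sum_(k <- c) p (f k^-1%g).
    by rewrite (le_trans (seminormB hp _ _))// /d0 mulrDl !mul1r lerD.
  have [k kc xk] := cV x.
  rewrite -(subrK (f k^-1%g) (f x)) (le_trans (seminormD hp _ _))// lerD//.
    by have := xk k^-1%g; rewrite mulgK.
  by rewrite (big_rem k)//= lerDl sumr_ge0// => *; exact: seminorm_ge0.
have step N : exists2 s : seq G, s <> [::] & forall g h,
    p (mean s (fun k => f (g * k)%g) - mean s (fun k => f (h * k)%g))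
      <= e' + e' + q ^+ N * d0.
  elim: N => [|N [s s0 IH]].
    exists [:: 1%g] => // g h; rewrite /mean !big_seq1/= invr1 !scale1r !mulg1.
    by rewrite expr0 mul1r (le_trans (d0P _ _))// lerDr addr_ge0// ltW.
  exists [seq (k * l)%g | k <- c, l <- s]; first exact: allpairs_neq0.
  move=> g h; rewrite !mean_allpairs.
  pose F x := mean s (fun k => f (x * k)%g).
  have FE x : (fun k => mean s (fun l => f (x * (k * l))%g)) =
      (fun k => F (x * k)%g).
    apply/funext => k; rewrite /F; congr mean; apply/funext => l.
    by rewrite mulgA.
  rewrite !FE.
  (* Averaging over right translates preserves the estimate for left translation by [v], so the same
     list [c] serves in every round. *)
  have Fe v : (forall x, p (f (v * x)%g - f x) <= e') -> p (F v - F 1%g) <= e'.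
    move=> ve; rewrite /F -meanB; apply: seminorm_mean => // k.
    by rewrite mul1g.
  apply: (le_trans (oscillation_contract cV Fe IH g h)).
  rewrite -/n mulrC ler_pdivrMr//.
  have qn : q * n%:R = n.-1%:R by rewrite divfK// gt_eqF.
  have nE : n%:R = n.-1%:R + 1 :> R by rewrite natr1 prednK// -(ltr0n R).
  rewrite exprS -mulrA mulrDl [q * _ * _]mulrAC qn nE.
  by rewrite le_eqVlt; apply/orP; left; apply/eqP; ring.
have [N qN] : exists N, q ^+ N * d0 <= e' + e'.
  have : (q ^+ k * d0) @[k --> \oo] --> (0 * d0 : R).
    by apply: cvgMl; apply: cvg_expr; rewrite ger0_norm.
  rewrite mul0r => /cvgrPdist_le/(_ (e' + e') (addr_gt0 e'0 e'0)).
  case=> N _ /(_ N (leqnn N))/=; rewrite sub0r normrN => qN.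
  by exists N; rewrite (le_trans (ler_norm _)).
have [s s0 sP] := step N; exists s => // g h.
rewrite (le_trans (sP g h))//.
have -> : e = (e' + e') + (e' + e').
  by rewrite /e'; have := splitr e; lra.
by rewrite lerD2l.
Qed.

End Oscillation.

(** * Limits of orbit averages *)

Section Reynolds.
Variables (R : realType) (A : lcAlgType R[i]) (G : topGroupType).
Variable alpha : dynamical_system A G.
Hypothesis A_complete : tvs_complete A.
Hypothesis G_compact : compact [set: G].
Implicit Types (a b : A) (g h k : G) (s t : seq G) (p : A -> R).

Definition orbit_mean s a : A := mean s (fun k => alpha k a).

Lemma dyn_mean (I : Type) g (s : seq I) (f : I -> A) :
  alpha g (mean s f) = mean s (fun i => alpha g (f i)).
Proof. by rewrite /mean linearZ/= raddf_sum. Qed.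

Lemma orbit_continuous a : continuous (fun g => alpha g a).
Proof.
move=> g; apply: (@continuous_comp _ _ _ (fun g => (g, a))
  (fun q : G * A => alpha q.1 q.2)); last exact: dyn_continuous.
by apply: cvg_pair => /=; [exact: cvg_id|exact: cvg_cst].
Qed.

Lemma dyn_act_continuous g : continuous (alpha g).
Proof.
move=> a; apply: (@continuous_comp _ _ _ (fun a => (g, a))
  (fun q : G * A => alpha q.1 q.2)); last exact: dyn_continuous.
by apply: cvg_pair => /=; [exact: cvg_cst|exact: cvg_id].
Qed.

Definition almost_invariant p (e : R) s a :=
  forall g, p (alpha g (orbit_mean s a) - orbit_mean s a) <= e.

(** Elements of [L] are treated one at a time by averaging again. As [p] need not be [G]-invariant,
    the new averages of earlier elements are compared with the old ones on both sides; this doubles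
    the error, hence [e / 2] in the induction. *)
Lemma almost_invariant_exists p (L : seq A) (e : R) : cseminorm p -> 0 < e ->
  exists2 s, s <> [::] & forall a, a \in L -> almost_invariant p e s a.
Proof.
move=> hp; elim: L e => [|a L IH] e e0; first by exists [:: 1%g].
have e20 : 0 < e / 2 by rewrite divr_gt0.
have [s s0 sL] := IH _ e20.
have [t t0 tP] := oscillation_mean G_compact hp
  (@orbit_continuous (orbit_mean s a)) e0.
exists [seq (k * l)%g | k <- t, l <- s]; first exact: allpairs_neq0.
have tsE b : orbit_mean [seq (k * l)%g | k <- t, l <- s] b =
    orbit_mean t (orbit_mean s b).
  rewrite /orbit_mean mean_allpairs; congr mean; apply/funext => k.
  by rewrite dyn_mean; congr mean; apply/funext => l; rewrite dyn_mul.
have actE g b : alpha g (orbit_mean t b) = mean t (fun k => alpha (g * k)%g b).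
  by rewrite dyn_mean; congr mean; apply/funext => k; rewrite dyn_mul.
move=> b; rewrite inE => /predU1P[->|bL] g; rewrite tsE actE.
  have -> : orbit_mean t (orbit_mean s a) =
      mean t (fun k => alpha (1 * k)%g (orbit_mean s a)).
    by congr mean; apply/funext => k; rewrite mul1g.
  exact: tP.
rewrite -meanB; apply: seminorm_mean => // k.
rewrite -(subrKA (orbit_mean s b)) (le_trans (seminormD hp _ _))//.
by rewrite [leRHS]splitr lerD ?sL// seminormBC// sL.
Qed.

(** Convergence along this filter means averaging ever more invariantly. The tolerance [1] is no
    loss, since seminorms may be rescaled. *)
Definition invariance_filter : set_system (seq G) :=
  [set Q | exists (L : seq A) p, cseminorm p /\ forall s, s <> [::] ->
    (forall a, a \in L -> almost_invariant p 1 s a) -> Q s].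

Instance invariance_filter_proper : ProperFilter invariance_filter.
Proof.
apply: Build_ProperFilter_ex.
  move=> Q [L [p [hp LQ]]].
  have [s s0 sL] := almost_invariant_exists L hp ltr01.
  by exists s; apply: LQ.
split.
- exists [::], (fun=> 0); split=> //; exact: cseminorm0.
- move=> P Q [L [p [hp LP]]] [M [q [hq MQ]]].
  exists (L ++ M), (fun x => p x + q x); split; first exact: cseminormD.
  move=> s s0 sLM; split; [apply: LP|apply: MQ] => // a aL g.
  + apply: le_trans (sLM a _ g); last by rewrite mem_cat aL.
    by rewrite lerDl seminorm_ge0.
  + apply: le_trans (sLM a _ g); last by rewrite mem_cat aL orbT.
    by rewrite lerDr seminorm_ge0.
- move=> P Q PQ [L [p [hp LP]]]; exists L, p; split=> // s s0 sL.
  exact/PQ/LP.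
Qed.

Lemma near_invariance p a (e : R) : cseminorm p -> 0 < e ->
  \forall s \near invariance_filter, s <> [::] /\ almost_invariant p e s a.
Proof.
move=> hp e0; exists [:: a], (fun x => e^-1 * p x).
split; first by apply: cseminormZ => //; rewrite invr_gt0.
move=> s s0 sa; split=> // g; have := sa a (mem_head _ _) g.
by rewrite ler_pdivrMl// mulr1.
Qed.

(* Both [P_s a] and [P_t a] are compared with one average on the other side,
   [z = mean_k (k^-1 a)]: left and right averages commute. *)
Lemma orbit_mean_cauchy a :
  tvs_cauchy (orbit_mean s a @[s --> invariance_filter]).
Proof.
move=> U /seminorm_basis[p hp pU].
(* Each average will be within two errors of [z], so two averages differ by at most [4 / 8 < 1]. *)
have e0 : 0 < (1 / 8 : R) by lra.
have Vcont : continuous (fun g => alpha g^-1%g a).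
  move=> g; apply: (@continuous_comp _ _ _ (fun g : G => g^-1%g)
    (fun g => alpha g a)).
    exact: topgroup_inv_continuous.
  exact: orbit_continuous.
have [t t0 tP] := oscillation_mean G_compact hp Vcont e0.
pose z := mean t (fun k => alpha (1 * k)^-1%g a).
exists [set y | p (y - z) <= 1 / 8 + 1 / 8]; last first.
  move=> x y /= xz yz; apply: pU => /=.
  rewrite -(subrKA z) (le_lt_trans (seminormD hp _ _))// (seminormBC hp z).
  by lra.
have := near_invariance a hp e0; apply: filterS => s [s0 sa].
set y := orbit_mean s a in sa *.
rewrite /= -(subrKA (mean t (fun k => alpha k^-1%g y))).
rewrite (le_trans (seminormD hp _ _))// lerD//.
  rewrite -[X in X - _](mean_cst y t0) -meanB seminorm_mean// => k.
  by rewrite seminormBC.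
(* Since [k^-1 l = (l^-1 k)^-1], each inner average is the one defining [z] with [1] replaced by
   [l^-1], so [tP] bounds the difference. *)
have -> : mean t (fun k => alpha k^-1%g y) =
    mean s (fun l => mean t (fun k => alpha (l^-1 * k)^-1%g a)).
  rewrite mean_exchange; congr mean; apply/funext => k.
  rewrite dyn_mean; congr mean; apply/funext => l.
  by rewrite invgM invgK dyn_mul.
rewrite -[z](mean_cst _ s0) -meanB; apply: seminorm_mean => // l; exact: tP.
Qed.

(** The identities hold for every nonempty average and pass to the limit, which is unique as [A] is
    Hausdorff; the limit is fixed because the averages are invariant up to arbitrarily small
    errors. *)
Lemma reynolds_operator : exists c : A -> fixed_algebra alpha,
  [/\ c 1 = 1, {morph c : a b / a + b} &
      forall a (b : fixed_algebra alpha), c (a * \val b) = c a * b].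
Proof.
have lim_ex a : exists x : A,
    orbit_mean s a @[s --> invariance_filter] --> x.
  have FP : ProperFilter (orbit_mean s a @[s --> invariance_filter]).
    exact: fmap_proper_filter.
  exact: (A_complete FP (@orbit_mean_cauchy a)).
have [r rP] := choice lim_ex.
have lim_unique (u : seq G -> A) (x y : A) :
    u s @[s --> invariance_filter] --> x ->
    u s @[s --> invariance_filter] --> y -> x = y.
  exact: (cvg_unique (@lcalg_hausdorff _ A)).
have rfix a : r a \in fixed_points alpha.
  apply/mem_set => g; apply/subr0_eq/seminorm_separated.
    exact: lcalg_hausdorff.
  move=> p hp; apply/eqP; rewrite eq_le seminorm_ge0// andbT.
  apply/ler_addgt0Pr => e e0; rewrite add0r.
  have e30 : 0 < e / 3 by rewrite divr_gt0.
  have r1 : \forall s \near invariance_filter,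
      p (orbit_mean s a - r a) < e / 3 :=
    rP a _ (seminorm_nbhs hp (r a) e30).
  have r2 : \forall s \near invariance_filter,
      p (alpha g (orbit_mean s a) - alpha g (r a)) < e / 3 :=
    rP a _ (dyn_act_continuous (seminorm_nbhs hp (alpha g (r a)) e30)).
  have [s [[/= s1 s2] [_ s3]]] := filter_ex (filterI (filterI r1 r2)
    (near_invariance a hp e30)).
  have {}s3 := s3 g.
  have -> : alpha g (r a) - r a = - (alpha g (orbit_mean s a) - alpha g (r a)) +
    (alpha g (orbit_mean s a) - orbit_mean s a) + (orbit_mean s a - r a).
    by rewrite opprB subrKA subrKA.
  rewrite (le_trans (seminormD hp _ _))//.
  have := seminormD hp (- (alpha g (orbit_mean s a) - alpha g (r a)))
    (alpha g (orbit_mean s a) - orbit_mean s a).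
  rewrite (seminormN hp); lra.
exists (fun a => SigSub (rfix a)); split.
- apply: val_inj => /=; apply: (lim_unique (orbit_mean ^~ 1)); first exact: rP.
  apply: cvg_near_cst; exists [::], (fun=> 0); split; first exact: cseminorm0.
  move=> s s0 _; rewrite /orbit_mean -[RHS](mean_cst 1 s0); congr mean.
  by apply/funext => k; exact: rmorph1.
- move=> a b; apply: val_inj => /=.
  apply: (lim_unique (orbit_mean ^~ (a + b))); first exact: rP.
  have -> : orbit_mean ^~ (a + b) = fun s => orbit_mean s a + orbit_mean s b.
    apply/funext => s; rewrite /orbit_mean -meanD; congr mean.
    apply/funext => k.
    exact: raddfD.
  apply: (cvg_comp2 (rP a) (rP b)); exact: (@add_continuous A (r a, r b)).
- have valM (x y : fixed_algebra alpha) : \val (x * y) = \val x * \val y.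
    exact: rmorphM.
  move=> a b; apply: val_inj; transitivity (r a * \val b); last exact/esym/valM.
  apply: (lim_unique (orbit_mean ^~ (a * \val b))); first exact: rP.
  have -> : orbit_mean ^~ (a * \val b) = fun s => orbit_mean s a * \val b.
    apply/funext => s; rewrite /orbit_mean /mean -scalerAl mulr_suml.
    congr (_ *: _); apply: eq_bigr => k _; rewrite rmorphM/=; congr (_ * _).
    exact: (set_mem (valP b)).
  apply: (cvg_comp2 (rP a) (cvg_cst (\val b))).
  exact: (@lcalg_mul_continuous _ A (r a, \val b)).
Qed.

End Reynolds.

(** * The Gelfand-Mazur theorem for quotients by maximal ideals *)

Section Ideal.
Variable (A : comPzRingType).
Implicit Types (M J : set A).

Definition ideal M := [/\ M 0, forall x y, M x -> M y -> M (x + y) &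
  forall a x, M x -> M (a * x)].

Lemma idealN M x : ideal M -> M x -> M (- x).
Proof. by move=> [_ _ MM] /(MM (-1)); rewrite mulN1r. Qed.

Lemma idealB M x y : ideal M -> M x -> M y -> M (x - y).
Proof.
by move=> iM Mx My; case: (iM) => _ MD _; apply: MD => //; exact: idealN.
Qed.

Lemma maximal_ideal J : ideal J -> ~ J 1 -> exists M,
  [/\ ideal M, J `<=` M, ~ M 1 & forall x, ~ M x -> exists s, M (s * x - 1)].
Proof.
move=> iJ J1.
pose P := [set M | M = set0 \/ [/\ ideal M, J `<=` M & ~ M 1]].
have [|M [PM Mmax]] := @Zorn_bigcup _ P.
  move=> F FP Ftot.
  have [[M0 [FM0 [m0 Mm0]]]|Fempty] :=
    pselect (exists M, F M /\ M !=set0); last first.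
    left; rewrite -subset0 => x [M FM Mx]; apply: Fempty.
    by exists M; split=> //; exists x.
  have good M x : F M -> M x -> [/\ ideal M, J `<=` M & ~ M 1].
    by move=> /FP[->|].
  right; split.
  - split.
    + by exists M0 => //; case: (good _ _ FM0 Mm0) => -[].
    + move=> x y [M FM Mx] [N FN Ny].
      have [[_ MD _] _ _] := good _ _ FM Mx.
      have [[_ ND _] _ _] := good _ _ FN Ny.
      have [MN|NM] := Ftot _ _ FM FN.
        by exists N => //; apply: ND => //; exact: MN.
      by exists M => //; apply: MD => //; exact: NM.
    + move=> a x [M FM Mx]; exists M => //.
      by have [[_ _ MM] _ _] := good _ _ FM Mx; exact: MM.
  - move=> x Jx; exists M0 => //.
    by have [_ JM _] := good _ _ FM0 Mm0; exact: JM.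
  - by move=> [M FM M1]; have [_ _] := good _ _ FM M1; apply.
case: PM => [M0|[iM JM M1]].
  exfalso; apply: (Mmax J); last by right; split=> //; exact: subset_refl.
  rewrite M0; split; first exact: sub0set.
  by move=> J0; case: iJ => /J0.
exists M; split=> // x Mx.
(* The ideal generated by [M] and [x]; by maximality it contains [1]. *)
pose N := [set y | exists m s, M m /\ y = m + s * x].
case: (iM) => M0 MD MM.
have MN : M `<=` N by move=> m Mm; exists m, 0; rewrite mul0r addr0.
have Nx : N x by exists 0, 1; rewrite mul1r add0r.
have [[m [s [Mm E]]]|N1] := pselect (N 1).
  exists s; rewrite E opprD addrCA subrr addr0; exact: idealN.
exfalso; apply: (Mmax N); first by split=> // /(_ _ Nx).
right; split=> //; last exact: subset_trans JM MN.
split; first exact: MN.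
- move=> _ _ [m [s [Mm ->]]] [n [t [Mn ->]]].
  by exists (m + n), (s + t); split; [exact: MD|rewrite mulrDl addrACA].
- move=> a _ [m [s [Mm ->]]].
  by exists (a * m), (a * s); split; [exact: MM|rewrite mulrDr mulrA].
Qed.

(** Allows a chosen inverse to be replaced by an explicit one inside any seminorm that vanishes on
    [M]. *)
Lemma inverse_mod_ideal_unique M s t x : ideal M ->
  M (s * x - 1) -> M (t * x - 1) -> M (s - t).
Proof.
move=> iM Ms Mt; case: (iM) => _ _ MM.
have -> : s - t = t * (s * x - 1) - s * (t * x - 1) by ring.
by apply: idealB => //; exact: MM.
Qed.

End Ideal.

(* Adding [k (x^2 + y^2)] with a small [k > 0] to [u] makes the four-point mean
   inequality strict, so that a maximum over a square lies on its boundary. *)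
Lemma four_point_max_principle (R : realType) (u : R -> R -> R) :
  continuous (fun q : R * R => u q.1 q.2) ->
  (forall e : R, 0 < e -> exists2 r : R, 0 < r &
    forall x y, r <= `|x| \/ r <= `|y| -> u x y <= e) ->
  (forall x y, exists2 C : R, 0 <= C &
    exists2 d : R, 0 < d & forall h : R, 0 < h < d ->
    4 * u x y <= u (x + h) y + u (x - h) y + u x (y + h) + u x (y - h)
                 + C * h ^+ 3) ->
  u 0 0 <= 0.
Proof.
move=> ucont uinf u4; apply/ler_addgt0Pr => e e0; rewrite add0r.
have e20 : 0 < e / 2 by rewrite divr_gt0.
have [r r0 ur] := uinf _ e20.
(* With this [k] the added term is at most [e / 2] on the square of half-side [r], and [u] is at
   most [e / 2] on its boundary. *)
pose k := e / (4 * r ^+ 2).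
have k0 : 0 < k by rewrite divr_gt0// mulr_gt0// exprn_gt0.
have kr : k * (r ^+ 2 + r ^+ 2) = e / 2.
  by rewrite /k; field; rewrite gt_eqF.
pose v (q : R * R) := u q.1 q.2 + k * (q.1 ^+ 2 + q.2 ^+ 2).
have vcont : continuous v.
  move=> q; apply: cvgD; first exact: ucont.
  apply: cvgMr; apply: cvgD.
    apply: (@continuous_comp _ _ _ fst (fun x : R => x ^+ 2)).
      exact: cvg_fst.
    exact: exprn_continuous.
  apply: (@continuous_comp _ _ _ snd (fun x : R => x ^+ 2)).
    exact: cvg_snd.
  exact: exprn_continuous.
pose Q : set (R * R) := `[- r, r] `*` `[- r, r].
have Q0 : Q (0, 0) by split; rewrite /= in_itv/= oppr_le0 ltW.
have Qc : compact Q by apply: compact_setX; exact: segment_compact.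
have [] := @compact_EVT_max _ _ v Q _ Qc.
- by exists (0, 0).
- exact: continuous_subspaceT.
move=> [x y] /set_mem[]; rewrite /= !in_itv/= -!ler_norml => xr yr vmax.
have u0 : u 0 0 <= v (x, y).
  have := vmax (0, 0) (mem_set Q0).
  by rewrite {1}/v/= expr0n/= addr0 mulr0 addr0.
apply: le_trans u0 _.
have sq_le (s : R) : `|s| <= r -> s ^+ 2 <= r ^+ 2.
  move=> sr; rewrite -[s ^+ 2]real_normK ?num_real// lerXn2r// ?nnegrE//.
  exact: ltW.
have x2 := sq_le _ xr; have y2 := sq_le _ yr.
have [bd|inn] : (r <= `|x| \/ r <= `|y|) \/ (`|x| < r /\ `|y| < r).
  have [x1|x1] := ltP `|x| r; last by left; left.
  by have [y1|y1] := ltP `|y| r; [right|left; right].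
  rewrite /v [leRHS]splitr lerD ?ur//= -kr ler_wpM2l ?lerD// ltW//.
case: inn => {}xr {}yr.
have [C C0 [d d0 uC]] := u4 x y.
exfalso.
(* The four neighbours stay in the square, the mean inequality applies, and [C * h ^+ 3] is less
   than [4 * k * h ^+ 2], the gain of the quadratic term: this contradicts maximality at
   [(x, y)]. *)
pose h :=
  Num.min (Num.min (d / 2) (k / (C + 1))) (Num.min (r - `|x|) (r - `|y|)).
have C1 : 0 < C + 1 by rewrite ltr_wpDl.
have d20 : 0 < d / 2 by rewrite divr_gt0.
have kC0 : 0 < k / (C + 1) by exact: divr_gt0.
have h0 : 0 < h by rewrite !lt_min !subr_gt0 xr yr d20 kC0.
have hx : `|x| + h <= r by rewrite addrC -lerBrDr /h !ge_min lexx !orbT.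
have hy : `|y| + h <= r by rewrite addrC -lerBrDr /h !ge_min lexx !orbT.
have hk : h <= k / (C + 1) by rewrite /h !ge_min lexx !orbT.
have hd : h < d.
  have : h <= d / 2 by rewrite /h !ge_min lexx.
  by lra.
have Qn (s t : R) : `|s| <= r -> `|t| <= r -> (s, t) \in Q.
  by move=> sr tr; apply/mem_set; split; rewrite /= in_itv/= -ler_norml.
have nD (s t : R) : `|s| + h <= r -> `|t| <= h -> `|s + t| <= r.
  by move=> sr th; rewrite (le_trans (ler_normD _ _))// (le_trans _ sr)// lerD2l.
have nh : `|h| <= h by rewrite gtr0_norm.
have nNh : `|- h| <= h by rewrite normrN gtr0_norm.
have v1 := vmax _ (Qn _ _ (nD _ _ hx nh) (ltW yr)).
have v2 := vmax _ (Qn _ _ (nD _ _ hx nNh) (ltW yr)).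
have v3 := vmax _ (Qn _ _ (ltW xr) (nD _ _ hy nh)).
have v4 := vmax _ (Qn _ _ (ltW xr) (nD _ _ hy nNh)).
have h0d : 0 < h < d by rewrite h0 hd.
have := uC _ h0d; rewrite /v /= in v1 v2 v3 v4 *.
have Ch : C * h ^+ 3 < 4 * k * h ^+ 2.
  rewrite exprSr mulrCA mulrC ltr_pM2r ?exprn_gt0//.
  move: hk; rewrite ler_pdivlMr// => hk.
  by nra.
move: v1 v2 v3 v4 Ch; rewrite !sqrrD sqrrN; nra.
Qed.

(** * The resolvent modulo an ideal *)

Section ResolventModIdeal.
Variables (R : realType) (A : comCiaType R[i]).
Implicit Types (p : A -> R) (M W : set A) (a b x : A) (z w : R[i]).

Lemma mul_near b a W : nbhs (b * a) W -> nbhs a [set x | W (b * x)].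
Proof.
move=> Wba; have /= := @lcalg_mul_continuous _ A (b, a) W Wba.
case=> -[X Y]/= [Xb Ya] XY; apply: filterS Ya => y Yy.
by apply: (XY (b, y)); split=> //=; exact: nbhs_singleton.
Qed.

(** The two axioms of a continuous inverse algebra, openness of the units and continuity of
    inversion at [1], enter through this lemma only. *)
Lemma inv1B_near W : nbhs (1 : A) W ->
  nbhs (0 : A) [set x | 1 - x \is a GRing.unit /\ W (1 - x)^-1].
Proof.
move=> W1.
have U1 : nbhs (1 : A) [set x | x \is a GRing.unit].
  by apply: open_nbhs_nbhs; split; [exact: cia_open_unit|exact: unitr1].
have V1 : nbhs (1 : A) [set x | x \is a GRing.unit -> W x^-1].
  by apply: (@cia_inv_continuous_at1 _ A); rewrite invr1.
have := @sub_continuous A (1, 0) _; rewrite /= subr0.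
move=> /(_ _ (filterI U1 V1))[[X Y]/= [X1 Y0] XY]; apply: filterS Y0 => y Yy.
have [/= yU yV] := XY (1, y) (conj (nbhs_singleton X1) Yy).
by split=> //; exact: yV.
Qed.

Lemma inv1B_scale_near b W : nbhs (1 : A) W -> exists2 d : R, 0 < d &
  forall w, modulus w < d -> 1 - w *: b \is a GRing.unit /\ W (1 - w *: b)^-1.
Proof. by move=> /inv1B_near/(scale_small b). Qed.

(** The gauge of [M + U], with [U] an absolutely convex neighbourhood inside [W]: a seminorm of
    [A / M] written on [A]. It vanishes on [M] because [M] is stable under scaling. *)
Lemma seminorm_mod_ideal M W : ideal M -> nbhs 0 W -> exists p,
  [/\ cseminorm p, forall m, M m -> p m = 0 &
      forall x, p x < 1 -> exists2 m, M m & W (x - m)].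
Proof.
move=> iM /absconvex_nbhs0[U [U0 UW Uconv]]; case: (iM) => M0 MD MM.
have MZ z m : M m -> M (z *: m).
  by move=> Mm; rewrite -[m]mul1r scalerAl; exact: MM.
pose V := [set x | exists2 m, M m & U (x - m)].
have UV : U `<=` V by move=> x Ux; exists 0; rewrite ?subr0.
have V0 : nbhs 0 V by exact: filterS U0.
have Vconv : absconvex V.
  move=> c d x y [m Mm Um] [n Mn Un] cd.
  exists (c *: m + d *: n); first by apply: MD; exact: MZ.
  by rewrite opprD addrACA -!scalerBr; exact: Uconv.
have hp := gauge_cseminorm V0 Vconv.
exists (gauge V); split=> // [m Mm|x /(gauge_lt1 V0 Vconv)[m Mm Um]]; last first.
  by exists m => //; exact: UW.
apply/eqP; rewrite eq_le (seminorm_ge0 hp) andbT; apply/ler_addgt0Pr => e e0.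
rewrite add0r; apply: gauge_le; split=> //; exists (e^-1%:C *: m).
  by exists (e^-1%:C *: m); [exact: MZ|rewrite subrr; exact: nbhs_singleton].
by rewrite scalerA -rmorphM/= mulfV ?gt_eqF// rmorph1 scale1r.
Qed.

Section Resolvent.
Variables (M : set A) (iM : ideal M) (p : A -> R) (hp : cseminorm p).
Hypothesis pM : forall m, M m -> p m = 0.
Variables (a : A) (S : R[i] -> A).
Hypothesis S_inv : forall z, M (S z * (a - z%:A) - 1).

Let p_congr x y : M (x - y) -> p x = p y.
Proof.
move=> /pM pxy; apply/eqP; rewrite -subr_eq0 -normr_le0 -pxy.
exact: seminorm_dist.
Qed.

(** Modulo [M], [a - (z + w)] equals [(a - z) * (1 - w *: S z)]; inverting both factors gives the
    formula. *)
Lemma resolvent_shift z w : 1 - w *: S z \is a GRing.unit ->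
  p (S (z + w)) = p (S z * (1 - w *: S z)^-1).
Proof.
move=> /mulVr; set v := _^-1 => vE; apply: p_congr.
apply: inverse_mod_ideal_unique (S_inv (z + w)) _ => //.
have -> : S z * v * (a - (z + w)%:A) - 1 = v * (S z * (a - z%:A) - 1).
  rewrite -[X in _ - X = _]vE -[w *: S z]mulr_algl scalerDl; ring.
by case: iM => _ _; apply.
Qed.

Lemma resolvent_continuous z (e : R) : 0 < e -> exists2 d : R, 0 < d &
  forall w, modulus w < d -> `|p (S (z + w)) - p (S z)| < e.
Proof.
move=> e0.
have N1 : nbhs (1 : A) [set v | p (S z * v - S z) < e].
  apply: (@mul_near (S z) 1 [set y | p (y - S z) < e]).
  by rewrite mulr1; exact: seminorm_nbhs.
have [d d0 dP] := inv1B_scale_near (S z) N1.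
exists d => // w /dP[wU /= wN]; rewrite resolvent_shift//.
exact: le_lt_trans (seminorm_dist hp _ _) _.
Qed.

Lemma resolvent_infinity (e : R) : 0 < e -> exists2 r : R, 0 < r &
  forall z, r <= modulus z -> p (S z) <= e.
Proof.
move=> e0; pose C := p 1 + 1.
have C0 : 0 < C by rewrite ltr_wpDl ?seminorm_ge0.
have N1 : nbhs (1 : A) [set v | p (v - 1) < 1] by exact: seminorm_nbhs.
have [d d0 dP] := inv1B_scale_near a N1.
(* Modulo [M], [S z = - z^-1 *: (1 - z^-1 *: a)^-1]. The terms [d^-1] bring [z^-1] below [d], so
   that [p] of the last factor is at most [C]; the term [C / e] then gives the bound [e]. *)
exists (d^-1 + d^-1 + C / e); first by rewrite !addr_gt0 ?invr_gt0 ?divr_gt0.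
move=> z rz.
have z0 : 0 < modulus z.
  by apply: lt_le_trans rz; rewrite !addr_gt0 ?invr_gt0 ?divr_gt0.
have zN0 : z != 0 by rewrite -modulus_eq0 gt_eqF.
have zd : modulus z^-1 < d.
  rewrite modulusV invf_plt ?posrE//; apply: lt_le_trans rz.
  by rewrite -addrA ltrDl addr_gt0 ?invr_gt0 ?divr_gt0.
have [/mulVr + /= vN] := dP _ zd; move: vN.
set v := _^-1 => vN vE.
have -> : p (S z) = p (- z^-1 *: v).
  apply: p_congr; apply: inverse_mod_ideal_unique (S_inv z) _ => //.
  have -> : - z^-1 *: v * (a - z%:A) - 1 = 0.
    have zz : z^-1%:A * z%:A = 1 :> A.
      by rewrite -scalerAl mul1r scalerA mulVf// scale1r.
    rewrite -[z^-1 *: a]mulr_algl in vE; rewrite scaleNr -[z^-1 *: v]mulr_algl.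
    transitivity (v * (z^-1%:A * z%:A - 1) + (v * (1 - z^-1%:A * a) - 1)).
      by ring.
    by rewrite zz vE !subrr mulr0 addr0.
  by case: iM.
rewrite (seminormZ hp) modulusN modulusV mulrC ler_pdivrMr//.
have pv : p v <= C.
  rewrite -(subrK 1 v) (le_trans (seminormD hp _ _))// /C addrC lerD2l.
  exact: ltW.
rewrite (le_trans pv)// mulrC -ler_pdivrMr//; apply: le_trans rz.
by rewrite lerDr addr_ge0// invr_ge0 ltW.
Qed.

(* The terms of order 1 and 2 of the resolvent expansion cancel in the sum over
   the four directions. *)
Lemma resolvent_four_point z : exists2 C : R, 0 <= C & exists2 d : R, 0 < d &
  forall h : R, 0 < h < d ->
    4 * p (S z) <= p (S (z + h%:C)) + p (S (z - h%:C)) +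
      p (S (z + 'i * h%:C)) + p (S (z - 'i * h%:C)) + C * h ^+ 3.
Proof.
pose b := S z; pose C := p (b ^+ 4) + 1.
have C0 : 0 <= C by rewrite addr_ge0 ?seminorm_ge0.
have N1 : nbhs (1 : A) [set v | p (b ^+ 4 * v) < C].
  have : nbhs (1 : A) [set v | p (b ^+ 4 * v - b ^+ 4) < 1].
    apply: (@mul_near (b ^+ 4) 1 [set y | p (y - b ^+ 4) < 1]).
    by rewrite mulr1; exact: seminorm_nbhs.
  apply: filterS => v /= pv.
  rewrite -(subrK (b ^+ 4) (b ^+ 4 * v)) (le_lt_trans (seminormD hp _ _))//.
  by rewrite /C addrC ltrD2l.
have [d d0 dP] := inv1B_scale_near b N1.
exists (4 * C); first by rewrite mulr_ge0.
exists d => // h /andP[h0 hd].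
(* [x] is the expansion of [S (z + w)] up to order 2; the remainder is [w ^+ 3 *: (b ^+ 4 * v)]. *)
have key w : modulus w = h -> exists2 x, p x <= p (S (z + w)) + C * h ^+ 3 &
    x = b + w%:A * b ^+ 2 + w%:A ^+ 2 * b ^+ 3.
  move=> wh; have wd : modulus w < d by rewrite wh.
  have [wU /= wN] := dP w wd.
  have /mulVr := wU; set v := _^-1 in wN * => vE.
  exists (b * v - w ^+ 3 *: (b ^+ 4 * v)).
    rewrite resolvent_shift// (le_trans (seminormB hp _ _))// lerD2l.
    have w3 : modulus (w ^+ 3) = h ^+ 3.
      by rewrite !exprS !expr0 !modulusM modulus1 wh.
    rewrite (seminormZ hp) w3 mulrC.
    by apply: ler_wpM2r; [exact/exprn_ge0/ltW|exact: ltW].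
  have {}vE : v = 1 + w%:A * b * v.
    by rewrite -{1}vE -[w *: b]mulr_algl; ring.
  have -> : w ^+ 3 *: (b ^+ 4 * v) = w%:A ^+ 3 * b ^+ 4 * v.
    by rewrite -[RHS]mulrA exprZn expr1n mulr_algl.
  (* Three substitutions of [v = 1 + c * b * v] produce the terms of order 0, 1, 2 and the cubic
     remainder. *)
  move: (w%:A) vE => c vE; clearbody v b; rewrite {1}vE {1}vE {1}vE.
  ring.
have mh : modulus h%:C = h by rewrite modulusR gtr0_norm.
have mi : modulus ('i * h%:C) = h.
  rewrite modulusM mh [modulus _](_ : _ = 1) ?mul1r//.
  by rewrite /modulus/= expr0n add0r expr1n sqrtr1.
have [x1 p1 E1] := key _ mh.
have [x2 p2 E2] := key (- h%:C) (etrans (modulusN _) mh).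
have [x3 p3 E3] := key _ mi.
have [x4 p4 E4] := key (- ('i * h%:C)) (etrans (modulusN _) mi).
have sumE : 4%:R *: b = x1 + x2 + x3 + x4.
  rewrite E1 E2 E3 E4 !scaleNr scaler_nat.
  have i2 : ('i * h%:C)%:A ^+ 2 = - (h%:C%:A ^+ 2) :> A.
    by rewrite !exprZn !expr1n exprMn sqr_i mulN1r scaleNr.
  rewrite !sqrrN i2; ring.
have : p (4%:R *: b) = 4 * p b.
  by rewrite (seminormZ hp) -(rmorph_nat (real_complex R)) modulusR ger0_norm.
rewrite sumE => <-.
have := seminormD hp (x1 + x2 + x3) x4.
have := seminormD hp (x1 + x2) x3.
have := seminormD hp x1 x2.
by lra.
Qed.

End Resolvent.
End ResolventModIdeal.

Lemma gelfand_mazur (R : realType) (A : comCiaType R[i]) (M : set A) :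
  ideal M -> ~ M 1 -> (forall x, ~ M x -> exists s, M (s * x - 1)) ->
  forall a, exists z : R[i], M (a - z%:A).
Proof.
move=> iM M1 Minv a; case: (iM) => _ MD MM.
apply: contrapT => noeig.
have S_ex z : exists s, M (s * (a - z%:A) - 1).
  by apply: Minv => Mz; apply: noeig; exists z.
have [S SP] := choice S_ex.
(* The seminorm is adapted to this neighbourhood: once [p (S 0) = 0], some [y = S 0 - m] with [m] in
   [M] makes [1 - a * y] a unit, yet [1 - a * y] lies in [M] because [a * S 0] is [1] modulo [M]. *)
have W0 : nbhs (0 : A) [set x | 1 - a * x \is a GRing.unit].
  apply: (@mul_near _ _ a 0 [set x | 1 - x \is a GRing.unit]); rewrite mulr0.
  by apply: filterS (inv1B_near filterT) => x [].
have [p [hp pM pW]] := seminorm_mod_ideal iM W0.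
suff pS0 : p (S (0 +i* 0)) <= 0.
  have [m Mm /= mU] := pW _ (le_lt_trans pS0 ltr01).
  have Mu : M (1 - a * (S 0 - m)).
    have -> : 1 - a * (S 0 - m) = a * m - (S 0 * (a - 0%:A) - 1).
      by rewrite scale0r; ring.
    by apply: idealB => //; exact: MM.
  by apply: M1; rewrite -(mulVr mU); exact: MM.
apply: (four_point_max_principle (u := fun x y => p (S (x +i* y)))).
- move=> [x y]; apply/cvgrPdist_lt => e e0.
  have [d d0 dP] := resolvent_continuous iM hp pM SP (x +i* y) e0.
  have d20 : 0 < d / 2 by rewrite divr_gt0.
  exists (ball x (d / 2), ball y (d / 2)).
    by split; exact: nbhsx_ballx.
  move=> [s t]; rewrite -!ball_normE/= distrC (distrC y) => -[sx ty].
  rewrite distrC.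
  have -> : s +i* t = (x +i* y) + ((s - x) +i* (t - y)).
    by apply/eqP; rewrite eq_complex/= !subrKC !eqxx.
  apply: dP; rewrite (le_lt_trans (modulus_le_ReIm _ _))//.
  by rewrite [ltRHS]splitr ltrD.
- move=> e e0; have [r r0 rP] := resolvent_infinity iM hp pM SP e0.
  exists r => // x y [xr|yr]; apply: rP.
    exact: le_trans xr (modulus_ge_Re _ _).
  exact: le_trans yr (modulus_ge_Im _ _).
- move=> x y; have [C C0 [d d0 dP]] := resolvent_four_point iM hp pM SP (x +i* y).
  exists C => //; exists d => // h /dP.
  have -> : (x +i* y) + h%:C = (x + h) +i* y.
    by apply/eqP; rewrite eq_complex/= addr0 !eqxx.
  have -> : (x +i* y) - h%:C = (x - h) +i* y.
    by apply/eqP; rewrite eq_complex/= subr0 !eqxx.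
  have -> : (x +i* y) + 'i * h%:C = x +i* (y + h).
    apply/eqP; rewrite eq_complex/=.
    by rewrite !(mul0r, mul1r, subr0, add0r, addr0) !eqxx.
  have -> : (x +i* y) - 'i * h%:C = x +i* (y - h).
    apply/eqP; rewrite eq_complex/=.
    by rewrite !(mul0r, mul1r, add0r, oppr0, subr0) !eqxx.
  by [].
Qed.

(** * Extension of characters from the fixed point algebra *)

Theorem corollary2p7 (R : realType) (A : comCiaType R[i]) (G : topGroupType)
    (alpha : dynamical_system A G)
    (A_complete : tvs_complete A)
    (G_compact : compact_group G) :
  forall psi : spectrum (fixed_algebra alpha),
    exists chi : spectrum A, char_restrict alpha chi = psi.
Proof.
move=> psi; set B := fixed_algebra alpha.
pose f : B -> R[i] := char_fun psi.
have [flin fM [b0 fb0]] : [/\ scalar f, {morph f : x y / x * y} &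
  exists b, f b != 0] := set_mem (valP psi).
have f1 : f 1 = 1.
  by apply: (mulfI fb0); rewrite -fM !mulr1.
have fD x y : f (x + y) = f x + f y.
  by have := flin 1 x y; rewrite scale1r mul1r.
have f0 : f 0 = 0 by apply: (addrI (f 0)); rewrite -fD !addr0.
have fZ z x : f (z *: x) = z * f x by rewrite -[_ *: _]addr0 flin f0 addr0.
have [c [c1 cD cM]] := reynolds_operator alpha A_complete G_compact.2.
have c0 : c 0 = 0 by apply: (addrI (c 0)); rewrite -cD !addr0.
(* the largest ideal of [A] contained in the kernel of [psi \o c] *)
pose J : set A := [set x | forall y, f (c (x * y)) = 0].
have iJ : ideal J.
  split=> [y|x y Jx Jy t|a x Jx y].
  - by rewrite mul0r c0.
  - by rewrite mulrDl cD fD Jx Jy addr0.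
  - by rewrite -mulrA mulrCA Jx.
have J1 : ~ J 1.
  by move=> /(_ 1); rewrite mulr1 c1 f1 => /eqP; rewrite oner_eq0.
have [M [iM JM M1 Minv]] := maximal_ideal iJ J1.
have [MM0 MMD MMM] := iM.
have [chi chiP] := choice (gelfand_mazur iM M1 Minv).
(* A nonzero scalar in [M] would put [1] in [M]. Hence each algebraic property of [chi] reduces to
   membership of one element in [M]. *)
have chi_unique a z : M (a - z%:A) -> chi a = z.
  move=> Maz; apply/eqP; rewrite -subr_eq0; apply: contrapT => /negP nz.
  apply: M1.
  have : M (((chi a - z)^-1)%:A * ((a - z%:A) - (a - (chi a)%:A))).
    by apply: MMM; apply: idealB.
  have -> : (a - z%:A) - (a - (chi a)%:A) = (chi a - z)%:A.
    by rewrite scalerBl; ring.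
  by rewrite mulr_algl scalerA mulVf// scale1r.
have chiL : scalar (chi : A -> R[i]).
  move=> k x y; apply: chi_unique.
  have -> : k *: x + y - (k * chi x + chi y)%:A =
      k%:A * (x - (chi x)%:A) + (y - (chi y)%:A).
    by rewrite scalerDl mulr_algl scalerBr scalerA opprD addrACA.
  by apply: MMD => //; exact: MMM.
have chiM : {morph (chi : A -> R[i]) : x y / x * y}.
  move=> x y; apply: chi_unique.
  have -> : x * y - (chi x * chi y)%:A =
      y * (x - (chi x)%:A) + (chi x)%:A * (y - (chi y)%:A).
    by rewrite -scalerA -[chi x *: _]mulr_algl; ring.
  by apply: MMD; exact: MMM.
have chi1 : chi 1 = 1 by apply: chi_unique; rewrite scale1r subrr.
have chi_char : (chi : {ptws A -> R[i]^o}) \in @characters R A.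
  by apply/mem_set; split=> //; exists 1; rewrite chi1 oner_eq0.
exists (SigSub chi_char); apply: val_inj; apply/funext => b.
(* It suffices that [b - f b] lies in [J]: by [A^G]-linearity [c] of its product with [y] is
   [c y * (b - f b)], which [f] kills. *)
change (chi (\val b) = f b); apply: chi_unique; apply: JM => y.
have -> : (\val b - (f b)%:A) * y = y * \val (b - (f b)%:A).
  by rewrite mulrC; congr (_ * _).
by rewrite cM fM fD -scaleNr fZ f1 mulr1 subrr mulr0.
Qed.
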